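(* Let $G$ be a graph, let $x\in V(G)$, and let $\ell\ge 1$ be an integer. If $\mathrm{gir}_x(G)\ge 5$, then $$\mathrm{MH}^{x}_{\ell,\ell}(G)\cong \mathbb{Z}^{\deg x}.$$
   Context: A graph means a finite simple undirected graph without loops, with nonempty vertex set $V(G)$ and edge set $E(G)$ (not necessarily connected); $\deg x$ is the number of vertices adjacent to $x$. An $i$-cycle ($i\ge 3$) in $G$ is a tuple $(x_0,\dots,x_i)$ of vertices with $\{x_k,x_{k+1}\}\in E(G)$ for $0\le k\le i-1$, $x_0=x_i$, and $x_0,\dots,x_{i-1}$ all distinct. The local girth at a vertex $x$ is $\mathrm{gir}_x(G)=\inf\{i\ge3 \mid \text{there is an } i\text{-cycle in } G \text{ containing } x\}$, with $\inf\emptyset=\infty$. Let $d(x,y)$ be the length of a shortest path between $x$ and $y$ ($\infty$ if there is none), and $L(x_0,\dots,x_k)=\sum_{i=1}^k d(x_{i-1},x_i)$. For integers $k,\ell\ge 0$, $\mathrm{MC}_{k,\ell}(G)$ is the free $\mathbb{Z}$-module generated by the tuples $(x_0,\dots,x_k)\in V(G)^{k+1}$ with $x_{i-1}\ne x_i$ for all $1\le i\le k$ and $L(x_0,\dots,x_k)=\ell$; $\mathrm{MC}_{-1,\ell}(G)=0$. The boundary map $\partial_{k,\ell}:\mathrm{MC}_{k,\ell}(G)\to\mathrm{MC}_{k-1,\ell}(G)$ is given for $k\ge1$ by $\partial_{k,\ell}(x_0,\dots,x_k)=\sum_{i} (-1)^i (x_0,\dots,\hat{x}_i,\dots,x_k)$,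 the sum over those $1\le i\le k-1$ with $d(x_{i-1},x_{i+1})=d(x_{i-1},x_i)+d(x_i,x_{i+1})$ (the hat means deletion), and $\partial_{0,\ell}=0$. The submodule $\mathrm{MC}^x_{k,\ell}(G)$ generated by those tuples with $x_0=x$ is a subcomplex, and the localized magnitude homology is $\mathrm{MH}^x_{k,\ell}(G)=\ker(\partial_{k,\ell}|_{\mathrm{MC}^x_{k,\ell}(G)})/\partial_{k+1,\ell}(\mathrm{MC}^x_{k+1,\ell}(G))$. *)

(* Defs.v *)
From HB Require Import structures.
From mathcomp Require Import all_boot all_order all_algebra.
From mathcomp Require Import boolp.

Set Implicit Arguments.
Unset Strict Implicit.
Unset Printing Implicit Defensive.

Import GRing.Theory.
Local Open Scope ring_scope.

(* Natural numbers extended with infinity, encoded as [option nat] with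
   [None] standing for infinity. *)
Definition natx := option nat.

Definition addx (a b : natx) : natx :=
  if a is Some m then if b is Some n then Some (m + n)%N else None else None.

Definition leqx (a b : natx) : bool :=
  match a, b with
  | _, None => true
  | None, Some _ => false
  | Some m, Some n => (m <= n)%N
  end.

Definition infx (P : pred nat) : natx :=
  if pselect (exists n, P n) is left Pn then Some (ex_minn Pn) else None.

Lemma infxP (P : pred nat) :
  match infx P with
  | Some m => P m /\ (forall n, P n -> (m <= n)%N)
  | None => forall n, ~~ P n
  end.
Proof.
rewrite /infx; case: pselect => [Pn|nP]; first by case: ex_minnP.
by move=> n; apply/negP => Pn; apply: nP; exists n.
Qed.

Lemma addxA : associative addx.
Proof. by move=> [a|] [b|] [c|] //=; rewrite addnA. Qed.

Lemma addxC : commutative addx.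
Proof. by move=> [a|] [b|] //=; rewrite addnC. Qed.

Lemma add0x : left_id (Some 0%N) addx.
Proof. by case. Qed.

HB.instance Definition _ := Monoid.isComLaw.Build natx (Some 0%N) addx
  addxA addxC add0x.

(* Nonemptiness of the vertex set is not a field: every statement below is
   about a given vertex. *)
Record graph := Graph {
  vertex :> finType;
  adj : rel vertex;
  adj_sym : symmetric adj;
  adj_irr : irreflexive adj
}.

Section LocalizedMagnitudeHomology.
Variable G : graph.
Implicit Types k l : nat.

Definition deg (x : G) : nat := #|[set y | adj x y]|.

(* [ucycleb (@adj G) c] says that the vertices listed in [c] are distinct, that
   consecutive ones are adjacent, and that the last one is adjacent to the
   first one; the closing vertex x_i = x_0 is not repeated in [c]. *)
Definition has_cycle_through (x : G) (i : nat) : bool :=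
  [exists c : i.-tuple G, ucycleb (@adj G) c && (x \in c)].

Definition local_girth (x : G) : natx :=
  infx (fun i => (3 <= i)%N && has_cycle_through x i).

(* [path] allows repeated vertices, which does not change the minimal length. *)
Definition has_path (x y : G) (n : nat) : bool :=
  [exists p : n.-tuple G, path (@adj G) x p && (last x p == y)].

Definition dist (x y : G) : natx := infx (has_path x y).

(* A tuple (x_0, ..., x_k) is a [k.+1.-tuple G]; [entry t i] is x_i, which is
   only meaningful for i <= k. *)
Definition entry k (t : k.+1.-tuple G) (i : nat) : G := tnth t (inord i).

Definition tuple_length k (t : k.+1.-tuple G) : natx :=
  \big[addx/Some 0%N]_(0 <= i < k) dist (entry t i) (entry t i.+1).

Definition is_gen k (l : nat) (t : k.+1.-tuple G) : bool :=
  [forall i : 'I_k, entry t i != entry t i.+1] && (tuple_length t == Some l).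

Definition MCgen k l := {t : k.+1.-tuple G | is_gen l t}.

Definition MC k l := {ffun MCgen k l -> int}.

(* The basis element given by [u]. It would be 0 if [u] were not a generator,
   but this never occurs in [boundary_gen], by [is_gen_face]. *)
Definition chain_of_tuple k l (u : k.+1.-tuple G) : MC k l :=
  [ffun s : MCgen k l => (val s == u)%:R].

Definition face k (i : 'I_k.+2) (t : k.+2.-tuple G) : k.+1.-tuple G :=
  [tuple tnth t (lift i j) | j < k.+1].

(* x_i is strictly between the ends of the tuple and lies on a shortest path
   from x_(i-1) to x_(i+1). *)
Definition smooth k (t : k.+2.-tuple G) (i : 'I_k.+2) : bool :=
  (0 < i < k.+1)%N &&
  (dist (entry t i.-1) (entry t i.+1)
     == addx (dist (entry t i.-1) (entry t i)) (dist (entry t i) (entry t i.+1))).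

Definition boundary_gen k l (t : k.+2.-tuple G) : MC k l :=
  \sum_(i : 'I_k.+2 | smooth t i) chain_of_tuple l (face i t) *~ (-1) ^+ i.

Definition boundary k l (c : MC k.+1 l) : MC k l :=
  \sum_(t : MCgen k.+1 l) boundary_gen l (val t) *~ c t.

(* The boundary map on MC_{0,l} is zero, since MC_{-1,l} = 0. *)
Definition is_cycle k l : pred (MC k l) :=
  match k return pred (MC k l) with
  | 0 => fun=> true
  | k'.+1 => fun c => boundary c == 0
  end.

Definition in_MCx (x : G) k l (c : MC k l) : bool :=
  [forall t : MCgen k l, (c t != 0) ==> (entry (val t) 0 == x)].

Lemma dist_eq0 (x y : G) : dist x y = Some 0%N -> x = y.
Proof.
rewrite /dist => d0; have := infxP (has_path x y); rewrite d0 => -[+ _].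
by case/existsP => p; rewrite (tuple0 p) /= => /eqP.
Qed.

Lemma dist_xx (x : G) : dist x x = Some 0%N.
Proof.
have := infxP (has_path x x); rewrite -/(dist x x).
have h0 : has_path x x 0 by apply/existsP; exists [tuple] => /=.
case: dist => [m [_ /(_ _ h0)]|/(_ 0%N)]; last by rewrite h0.
by rewrite leqn0 => /eqP ->.
Qed.

Lemma entry_face k (t : k.+2.-tuple G) (i : 'I_k.+2) j : (j < k.+1)%N ->
  entry (face i t) j = entry t (bump i j).
Proof.
move=> jk; rewrite /entry tnth_mktuple; congr tnth; apply: val_inj => /=.
have bk : (bump i j < k.+2)%N.
  by rewrite ltnS /bump; case: (i <= j)%N; rewrite ?add1n ?add0n // ltnW.
by rewrite !inordK.
Qed.

Lemma entry_face_lt k (t : k.+2.-tuple G) (i : 'I_k.+2) j : (j < i)%N ->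
  entry (face i t) j = entry t j.
Proof.
move=> ji; rewrite entry_face; last by rewrite (leq_trans ji) // -ltnS ltn_ord.
by rewrite /bump leqNgt ji.
Qed.

Lemma entry_face_ge k (t : k.+2.-tuple G) (i : 'I_k.+2) j :
  (i <= j)%N -> (j < k.+1)%N -> entry (face i t) j = entry t j.+1.
Proof. by move=> ij jk; rewrite entry_face // /bump ij. Qed.

Lemma tuple_length_face k (t : k.+2.-tuple G) (i : 'I_k.+2) :
  smooth t i -> tuple_length (face i t) = tuple_length t.
Proof.
case: i => [[|m] mk] // /andP[/= mk1 /eqP dE]; have mk2 : (m < k)%N by [].
have mk3 : (m < k.+1)%N by exact: ltnW.
rewrite /tuple_length (big_cat_nat (n := m)) ?(ltnW mk2) //=.
rewrite [RHS](big_cat_nat (n := m)) ?(ltnW mk3) //=; congr addx.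
  rewrite !big_nat; apply: eq_bigr => j /= jm.
  by rewrite !entry_face_lt //= ltnW.
rewrite big_ltn // [RHS]big_ltn // [in RHS]big_ltn // addxA -dE; congr addx.
  by rewrite entry_face_lt ?entry_face_ge.
rewrite [RHS]big_add1 /= !big_nat; apply: eq_bigr => j /andP[mj jk].
by rewrite !entry_face_ge //= ltnW.
Qed.

Lemma is_gen_face k l (t : k.+2.-tuple G) (i : 'I_k.+2) :
  is_gen l t -> smooth t i -> is_gen l (face i t).
Proof.
move=> /andP[/forallP tN tl] ti; rewrite /is_gen tuple_length_face // tl andbT.
have tN' j : (j < k.+1)%N -> entry t j != entry t j.+1.
  by move=> jk; apply: (tN (Ordinal jk)).
apply/forallP => -[j jk] /=.
case: i ti => [[|m] mk] // /andP[/= mk1 /eqP dE].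
case: (ltngtP m j) => [mj|jm|mj].
- by rewrite !entry_face_ge //= ?tN' // ltnW.
- by rewrite !entry_face_lt //= ?tN' // ltnW.
rewrite -mj entry_face_lt ?entry_face_ge //=.
apply: contraNN (tN' m (ltnW mk1)) => /eqP e.
have := dist_xx (entry t m); rewrite {2}e dE.
case dm: (dist _ _) => [[|a]|] //; case: (dist _ _) => //= b _.
by rewrite (dist_eq0 dm).
Qed.

Lemma boundary_is_zmod_morphism k l : zmod_morphism (@boundary k l).
Proof.
move=> c d; rewrite /boundary -sumrB; apply: eq_bigr => t _.
by rewrite !ffunE mulrzBr.
Qed.

HB.instance Definition _ k l :=
  GRing.isZmodMorphism.Build (MC k.+1 l) (MC k l) (@boundary k l)
    (@boundary_is_zmod_morphism k l).

Lemma in_MCx_zmod_closed x k l : zmod_closed [pred c : MC k l | in_MCx x c].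
Proof.
split=> [|c d]; first by apply/forallP => t; rewrite ffunE eqxx.
move=> /forallP cP /forallP dP; apply/forallP => t; apply/implyP.
apply: contraNT => tx; rewrite !ffunE.
have /eqP -> : c t == 0 by apply: contraTT (cP t) => ct; rewrite negb_imply ct.
have /eqP -> : d t == 0 by apply: contraTT (dP t) => dt; rewrite negb_imply dt.
by rewrite subrr.
Qed.

Definition cycles_pred (x : G) k l : {pred MC k l} :=
  fun c => in_MCx x c && is_cycle c.

Lemma cycles_zmod_closed x k l : zmod_closed (@cycles_pred x k l).
Proof.
have [z0 zB] := in_MCx_zmod_closed x k l; split.
  rewrite unfold_in /cycles_pred; apply/andP; split; first exact: z0.
  by case: {z0 zB} k => //= k; rewrite raddf0.
move=> c d /andP[cx cc] /andP[dx dc]; rewrite unfold_in /cycles_pred.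
apply/andP; split; first exact: zB.
case: k c d cx cc dx dc {z0 zB} => //= k c d _ /eqP cc _ /eqP dc.
by rewrite raddfB /= cc dc subrr.
Qed.

HB.instance Definition _ x k l :=
  GRing.isZmodClosed.Build (MC k l) (@cycles_pred x k l)
    (cycles_zmod_closed x k l).

(* The kernel of the boundary map on MC^x_{k,l}. *)
Record cycles (x : G) k l :=
  Cycle { chain_of_cycle :> MC k l; _ : chain_of_cycle \in @cycles_pred x k l }.

HB.instance Definition _ x k l := [isSub for @chain_of_cycle x k l].
HB.instance Definition _ x k l := [Choice of cycles x k l by <:].
HB.instance Definition _ x k l :=
  [SubChoice_isSubZmodule of cycles x k l by <:].

(* The image of MC^x_{k+1,l} under the boundary map, as a predicate on the
   kernel; it is the whole image because the boundary map squares to zero. *)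
Definition boundaries (x : G) k l : {pred cycles x k l} :=
  fun z => `[< exists2 c : MC k.+1 l, in_MCx x c & boundary c = z >].

Lemma boundaries_zmod_closed x k l : zmod_closed (@boundaries x k l).
Proof.
have [z0 zB] := in_MCx_zmod_closed x k.+1 l; split.
  by apply/asboolP; exists 0; rewrite ?raddf0.
move=> z w /asboolP[c cx cz] /asboolP[d dx dw]; apply/asboolP.
by exists (c - d); [exact: zB | rewrite raddfB /= cz dw].
Qed.

HB.instance Definition _ x k l :=
  GRing.isZmodClosed.Build (cycles x k l) (@boundaries x k l)
    (boundaries_zmod_closed x k l).

Definition MH (x : G) k l : zmodType :=
  @Quotient.quot (cycles x k l) (@boundaries x k l).

End LocalizedMagnitudeHomology.

(* An isomorphism of Z-modules is a bijective additive map. *)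
Definition isomorphic (U V : zmodType) : Prop :=
  exists f : {additive U -> V}, bijective f.

(* Main.v *)
Require Import Defs.
From mathcomp Require Import all_boot all_order all_algebra.
From HB Require Import structures.
From mathcomp Require Import boolp zify.

(** A tuple of [l + 1] vertices, consecutive ones distinct, has length at least
    [l], with equality exactly for walks; hence [MC_{l+1,l} = 0] and
    [MH^x_{l,l}] is the group of cycles supported on walks from [x].  Since no
    triangle or 4-cycle passes through [x], a walk with [x_(i+1) != x_(i-1)]
    and [x] in [{x_(i-1), x_i}] has [d(x_(i-1), x_(i+1)) = 2], and [x_i] is the
    only midpoint; no other walk has the same [i]-th face, so a cycle vanishes
    on it.  By induction on [i], cycles are supported on the walks
    [(x, y, x, y, ...)], which have no smooth position and so are themselves
    cycles, one for each neighbour [y] of [x]. *)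

Set Implicit Arguments.
Unset Strict Implicit.
Unset Printing Implicit Defensive.

Import GRing.Theory.
Local Open Scope ring_scope.

(** * Sums in [natx] and multiples of integer-valued functions *)

(** A finite total excludes infinite terms, so each term is at least 1; a total equal to the number
    of terms leaves no slack. *)
Lemma sum_natx_bound (F : nat -> natx) k m :
    (forall i, (i < k)%N -> F i != Some 0%N) ->
    \big[addx/Some 0%N]_(0 <= i < k) F i = Some m ->
  (k <= m)%N /\ (m = k -> forall i, (i < k)%N -> F i = Some 1%N).
Proof.
elim: k m => [|k IHk] m F0; first by rewrite big_geq // => -[<-].
rewrite big_nat_recr //=; case ES: (\big[_/_]_(0 <= i < k) F i) => [a|] //=.
have := F0 k (ltnSn k); case EF: (F k) => [[|b]|] //= _ [<-].
have [ka a1] := IHk a (fun i ik => F0 i (ltnW ik)) ES.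
split=> [|abk i]; first lia.
rewrite ltnS leq_eqVlt => /orP[/eqP ->|ik]; first by rewrite EF; congr Some; lia.
by apply: a1 => //; lia.
Qed.

Lemma sum_natx1 (F : nat -> natx) k :
  (forall i, (i < k)%N -> F i = Some 1%N) ->
  \big[addx/Some 0%N]_(0 <= i < k) F i = Some k.
Proof.
elim: k => [|k IHk] F1; first by rewrite big_geq.
by rewrite big_nat_recr //= IHk ?F1 //= ?addn1 // => i ik; apply: F1; apply: ltnW.
Qed.

Lemma ffunMzE (aT : finType) (V : zmodType) (f : {ffun aT -> V}) (n : int) a :
  (f *~ n) a = f a *~ n.
Proof. by case: n => n; rewrite ?NegzE -?pmulrn ?mulrNz ?ffunE ffunMnE. Qed.

(** * Distances 1 and 2 in terms of adjacency *)

Section Distance.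
Variable G : graph.
Implicit Types a b c : G.

Lemma has_path1 a b : has_path a b 1 = adj a b.
Proof.
apply/existsP/idP => [[p]|ab].
  by case: p => -[|c [|? ?]] //= _; rewrite andbT => /andP[ac /eqP <-].
by exists [tuple b]; rewrite /= ab eqxx.
Qed.

Lemma adj_neq a b : adj a b -> a != b.
Proof. by apply: contraTneq => ->; rewrite adj_irr. Qed.

Lemma dist_le a b n : has_path a b n -> exists2 m, dist a b = Some m & (m <= n)%N.
Proof.
move=> ab; have := infxP (has_path a b); rewrite -/(dist a b).
by case: dist => [m [_ /(_ _ ab)]|/(_ n)]; [exists m | rewrite ab].
Qed.

Lemma dist1E a b : (dist a b == Some 1%N) = adj a b.
Proof.
apply/eqP/idP => [d1|ab].
  by have := infxP (has_path a b); rewrite -/(dist a b) d1 has_path1 => -[].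
have [|[|[|m]] // d0 _] := @dist_le a b 1; first by rewrite has_path1.
by rewrite (dist_eq0 d0) adj_irr in ab.
Qed.

Lemma dist2 a b c : adj a b -> adj b c -> a != c -> ~~ adj a c ->
  dist a c = Some 2%N.
Proof.
move=> ab bc ac nac; have [|[|[|[|m]]] // d0 _] := @dist_le a c 2.
- by apply/existsP; exists [tuple b; c]; rewrite /= ab bc eqxx.
- by rewrite (dist_eq0 d0) eqxx in ac.
- by move/eqP: d0; rewrite dist1E (negPf nac).
Qed.

End Distance.

(** * Walks as generators, and their faces *)

Section Walks.
Variable G : graph.

Lemma eq_from_entry k (t u : k.+1.-tuple G) :
  (forall i, (i < k.+1)%N -> entry t i = entry u i) -> t = u.
Proof.
by move=> tu; apply: eq_from_tnth => i; have := tu i (ltn_ord i); rewrite /entry inord_val.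
Qed.

Lemma is_gen_walkP l (t : l.+1.-tuple G) :
  reflect (forall i, (i < l)%N -> adj (entry t i) (entry t i.+1)) (is_gen l t).
Proof.
apply: (iffP andP) => [[/forallP tN /eqP tl] i il|tA].
  rewrite -dist1E; apply/eqP.
  have [|_ /(_ erefl)] := sum_natx_bound _ tl; last exact.
  move=> j jl; have := tN (Ordinal jl); apply: contraNneq => /dist_eq0 /= ->.
  by rewrite eqxx.
split; first by apply/forallP => i; apply/adj_neq/tA.
by apply/eqP/sum_natx1 => i il; apply/eqP; rewrite dist1E tA.
Qed.

Lemma not_is_gen_short l (t : l.+2.-tuple G) : ~~ is_gen l t.
Proof.
apply/negP => /andP[/forallP tN /eqP tl].
have [|] := sum_natx_bound _ tl; last by rewrite ltnn.
move=> j jl; have := tN (Ordinal jl); apply: contraNneq => /dist_eq0 /= ->.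
by rewrite eqxx.
Qed.

(** The sum runs over an empty set of generators. Hence the diagonal homology is the group of cycles
    itself. *)
Lemma boundary_short l (c : MC G l.+1 l) : boundary c = 0.
Proof.
by apply: big1 => -[t tg]; have := not_is_gen_short t; rewrite tg.
Qed.

Section Smooth.
Variables (n : nat) (t : n.+2.-tuple G).
Hypothesis tg : is_gen n.+1 t.

(** Both steps at [x_i] have length 1, so the sum of distances in [smooth] is 2. *)
Lemma smooth_walkE (i : 'I_n.+2) :
  smooth t i = (0 < i < n.+1)%N && (dist (entry t i.-1) (entry t i.+1) == Some 2%N).
Proof.
have /is_gen_walkP tA := tg; rewrite /smooth; case: i => -[|i] //= ilt.
case: ltnP => // il.
have /eqP -> : dist (entry t i) (entry t i.+1) == Some 1%N by rewrite dist1E tA.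
by have /eqP -> : dist (entry t i.+1) (entry t i.+2) == Some 1%N by rewrite dist1E tA.
Qed.

(** Together with [dist_face_off], this recovers the deleted index from a face of a walk: the step
    of length 2 marks it. *)
Lemma dist_face_smooth (i : 'I_n.+2) : smooth t i ->
  dist (entry (face i t) i.-1) (entry (face i t) i) = Some 2%N.
Proof.
rewrite smooth_walkE => /andP[/andP[i0 il] /eqP d2].
by rewrite entry_face_lt ?entry_face_ge //; lia.
Qed.

Lemma dist_face_off (i j : 'I_n.+2) : (0 < j < n.+1)%N -> i != j ->
  dist (entry (face i t) j.-1) (entry (face i t) j) = Some 1%N.
Proof.
have /is_gen_walkP tA := tg.
move=> /andP[j0 jl] /eqP ij; apply/eqP; rewrite dist1E.
have {}ij : (i : nat) <> j by move=> /val_inj.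
case: (ltngtP i j) => [lij|lji|//].
  rewrite !entry_face_ge //; try lia.
  by rewrite prednK // tA.
rewrite !entry_face_lt; try lia.
by have := tA j.-1; rewrite prednK //; apply; lia.
Qed.

End Smooth.

(** For distinct indices, the step ending at position [j] of the common face would have both length
    2 and length 1. *)
Lemma face_eq_index n (t u : n.+2.-tuple G) (i j : 'I_n.+2) :
  is_gen n.+1 t -> is_gen n.+1 u -> smooth u j -> face j u = face i t -> j = i.
Proof.
move=> tg ug uj fE; apply/eqP; rewrite eq_sym; apply: contraT => ij.
have := dist_face_smooth ug uj; rewrite fE dist_face_off //.
by case/andP: uj.
Qed.

Lemma boundaryE k l (c : MC G k.+1 l) s :
  boundary c s = \sum_(t : MCgen G k.+1 l)
    \sum_(i : 'I_k.+2 | smooth (val t) i)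
      (val s == face i (val t))%:R * (-1) ^+ i * c t.
Proof.
rewrite /boundary sum_ffunE; apply: eq_bigr => t _.
rewrite ffunMzE /boundary_gen sum_ffunE -mulrzr mulr_suml intz.
by apply: eq_bigr => i _; rewrite ffunMzE ffunE -mulrzr intz.
Qed.

Lemma boundary_chain_of_tuple k l (t : k.+2.-tuple G) : is_gen l t ->
  boundary (chain_of_tuple l t) = boundary_gen l t.
Proof.
move=> tg; rewrite /boundary (bigD1 (exist _ t tg)) //= big1 ?addr0.
  by rewrite ffunE eqxx.
by move=> u; rewrite ffunE -val_eqE /= => /negPf ->; rewrite mulr0z.
Qed.

End Walks.

(** * Consequences of local girth at least 5, and the support of cycles *)

Section Girth.
Variables (G : graph) (x : G).
Hypothesis hgir : leqx (Some 5%N) (local_girth x).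

Lemma no_short_cycle i : (3 <= i < 5)%N -> ~~ has_cycle_through x i.
Proof.
case/andP=> i3 i5; apply/negP => ci.
have := infxP (fun i => (3 <= i)%N && has_cycle_through x i).
rewrite -/(local_girth x).
(* A finite girth [m] is at least 5 and minimal; an infinite one admits no cycle through [x] at
   all. *)
case: local_girth hgir => [m /= m5 [_ /(_ i)]|_ /(_ i)]; rewrite i3 ci //.
by move=> /(_ isT); lia.
Qed.

Lemma no_triangle a b : adj x a -> adj a b -> ~~ adj b x.
Proof.
move=> xa ab; apply: contra (@no_short_cycle 3 isT) => bx.
apply/existsP; exists [tuple x; a; b]; rewrite inE eqxx andbT /ucycleb /=.
rewrite xa ab bx /= !inE (negPf (adj_neq xa)) (negPf (adj_neq ab)) andbT.
by rewrite eq_sym (negPf (adj_neq bx)).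
Qed.

Lemma common_neighbor_unique a b c :
  adj x a -> adj a b -> x != b -> adj x c -> adj c b -> a = c.
Proof.
move=> xa ab xb xc cb; apply/eqP/contraT => ac.
have /negP[] := @no_short_cycle 4 isT.
apply/existsP; exists [tuple x; a; b; c]; rewrite inE eqxx andbT /ucycleb /=.
rewrite xa ab (adj_sym b) cb (adj_sym c) xc /= !inE.
rewrite (negPf (adj_neq xa)) (negPf (adj_neq ab)) (negPf xb) (negPf ac).
by rewrite (negPf (adj_neq xc)) eq_sym (negPf (adj_neq cb)).
Qed.

Lemma unique_midpoint a b b' c : (a == x) || (b == x) ->
  adj a b -> adj b c -> a != c ->
  ~~ adj a c /\ (adj a b' -> adj b' c -> b' = b).
Proof.
case/orP => /eqP -> => [xb bc xc|ax xc ac].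
  split=> [|xb' b'c]; first by rewrite adj_sym (no_triangle xb bc).
  exact: common_neighbor_unique xb' b'c xc xb bc.
split=> [|ab' b'c].
  by apply/negP => /(no_triangle (etrans (adj_sym _ _) ax)); rewrite adj_sym xc.
(* Here [x] itself is the midpoint; another midpoint [b'] would close the 4-cycle [x, a, b', c]. *)
apply/eqP/contraT => b'x; move: ac.
suff -> : a = c by rewrite eqxx.
by apply: (common_neighbor_unique (b := b')); rewrite // 1?adj_sym // eq_sym.
Qed.

(** Evaluating [boundary c] at the [i]-th face of [t] isolates [c t] up to sign. *)
Lemma cycle_vanishes n (c : MC G n.+1 n.+1) (t : MCgen G n.+1 n.+1)
    (i : 'I_n.+2) :
    (0 < i < n.+1)%N -> boundary c = 0 ->
    (entry (val t) i.-1 == x) || (entry (val t) i == x) ->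
    entry (val t) i.-1 != entry (val t) i.+1 ->
  c t = 0.
Proof.
move=> ib c0 tx tN; have /is_gen_walkP tA := valP t.
case/andP: (ib) => i0 il.
have tA1 : adj (entry (val t) i.-1) (entry (val t) i).
  by have := tA i.-1; rewrite prednK //; apply; lia.
have tA2 : adj (entry (val t) i) (entry (val t) i.+1) by apply: tA.
(* The argument [x] is a dummy competitor: only the non-adjacency is kept. *)
have [nadj _] := unique_midpoint x tx tA1 tA2 tN.
have ti : smooth (val t) i.
  by rewrite smooth_walkE ?(valP t) // ib (dist2 tA1 tA2 tN nadj) eqxx.
have uE u (j : 'I_n.+2) : is_gen n.+1 u -> smooth u j ->
    face j u = face i (val t) -> j = i /\ u = val t.
  move=> ug uj fE; have ji := face_eq_index (valP t) ug uj fE.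
  subst j; split=> //.
  (* All vertices except the [i]-th survive in the common face, those after it with index lowered by
     1. *)
  have off m : (m < n.+2)%N -> m != i -> entry u m = entry (val t) m.
    case: (ltngtP m i) => // [mi|im] mn _.
      by rewrite -!(entry_face_lt _ mi) fE.
    by case: m im mn => // m im mn; rewrite -!(@entry_face_ge _ _ _ i) ?fE.
  apply: eq_from_entry => m mn.
  have [->|] := eqVneq m i; last exact: off.
  have /is_gen_walkP uA := ug.
  (* The remaining vertex of [u] is a midpoint between the same two neighbours as that of [t]. *)
  have [_] := unique_midpoint (entry u i) tx tA1 tA2 tN; apply.
    rewrite -off; [|lia..].
    by have := uA i.-1; rewrite prednK //; apply; lia.
  by rewrite -off; [rewrite uA|lia..].
have fg := is_gen_face (valP t) ti.
have := congr1 (fun b : MC G n n.+1 => b (Sub (face i (val t)) fg)) c0.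
rewrite boundaryE ffunE (bigD1 t) //= (bigD1 i) //= !big1 ?addr0 => [|u ut|j].
- by rewrite eqxx mul1r => /eqP; rewrite mulf_eq0 signr_eq0 /= => /eqP.
- apply: big1 => j uj; have [fE|] := eqVneq; last by rewrite !mul0r.
  have [_ /val_inj ute] := uE _ _ (valP u) uj (esym fE).
  by rewrite ute eqxx in ut.
- case/andP => tj ji; have [fE|] := eqVneq; last by rewrite !mul0r.
  by have [je] := uE _ _ (valP t) tj (esym fE); rewrite je eqxx in ji.
Qed.

Definition alt_tuple n (y : G) : n.+1.-tuple G :=
  [tuple if odd i then y else x | i < n.+1].

Lemma entry_alt n y i : (i < n.+1)%N ->
  entry (alt_tuple n y) i = if odd i then y else x.
Proof. by move=> il; rewrite /entry tnth_mktuple inordK. Qed.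

Lemma is_gen_alt n y : adj x y -> is_gen n (alt_tuple n y).
Proof.
move=> xy; apply/is_gen_walkP => i il; rewrite !entry_alt //=; last by apply: ltnW.
by case: odd; rewrite //= adj_sym.
Qed.

(** The two neighbours of an interior position coincide, so their distance is 0 rather than 2. *)
Lemma boundary_alt n y : adj x y ->
  boundary (chain_of_tuple n.+1 (alt_tuple n.+1 y)) = 0.
Proof.
move=> xy; have ag := is_gen_alt n.+1 xy.
rewrite boundary_chain_of_tuple //; apply: big_pred0 => i.
rewrite smooth_walkE //; case: i => -[|i] //= il; case: ltnP => // i1.
by rewrite !entry_alt //= ?negbK ?dist_xx //; lia.
Qed.

Lemma cycle_support n (c : MC G n.+1 n.+1) (t : MCgen G n.+1 n.+1) :
  boundary c = 0 -> entry (val t) 0 = x -> c t != 0 ->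
  val t = alt_tuple n.+1 (entry (val t) 1).
Proof.
move=> c0 t0 ct; apply: eq_from_entry => i; elim/ltn_ind: i => -[|[|i]] IH il.
- by rewrite entry_alt.
- by rewrite entry_alt.
rewrite entry_alt //= negbK; rewrite -ltnS in il.
have IHi := IH i (ltnW (ltnSn _)); have IHi1 := IH i.+1 (ltnSn _).
rewrite !entry_alt //= in IHi IHi1; [|lia..].
(* By periodicity the goal becomes equality of the entries at [i.+2] and [i]; otherwise
   [cycle_vanishes] applies at index [i.+1]. *)
rewrite -IHi; last lia.
apply/eqP; rewrite eq_sym; apply: contraNT ct => tN.
have i2 : (i.+1 < n.+2)%N by lia.
apply/eqP/(cycle_vanishes (i := Ordinal i2)) => //=.
(* By parity, one of the entries at [i] and [i.+1] is [x]. *)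
rewrite IHi ?IHi1; [|lia..].
by case: odd; rewrite eqxx ?orbT.
Qed.

End Girth.

(** * Coordinates of homology classes on the alternating walks *)

Section Isomorphism.
Local Open Scope quotient_scope.
Variables (G : graph) (x : G) (n : nat).
Hypothesis hgir : leqx (Some 5%N) (local_girth x).

Let l := n.+1.

Lemma boundariesE (z : cycles x l l) : (z \in @boundaries G x l l) = (z == 0).
Proof.
apply/idP/eqP => [/asboolP[c _]|->]; last exact: rpred0.
by rewrite boundary_short => z0; apply/val_inj; rewrite /= -z0.
Qed.

(** The quotient is by the zero subgroup, so each class contains a single cycle. *)
Lemma repr_pi (z : cycles x l l) : repr (\pi_(MH x l l) z) = z.
Proof.
apply/eqP; rewrite -subr_eq0 -boundariesE Quotient.idealrBE.
by rewrite -[_ == _]/(_ == _ :> MH x l l) reprK.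
Qed.

Lemma adj_enum_val (j : 'I_(deg x)) : adj x (enum_val j : G).
Proof. by have := enum_valP j; rewrite inE. Qed.

Definition alt_gen (j : 'I_(deg x)) : MCgen G l l :=
  exist _ (alt_tuple x l (enum_val j)) (is_gen_alt l (adj_enum_val j)).

Definition alt_chain (v : 'rV[int]_(deg x)) : MC G l l :=
  \sum_j chain_of_tuple l (alt_tuple x l (enum_val j)) *~ v 0 j.

Lemma alt_chain_gen v j : alt_chain v (alt_gen j) = v 0 j.
Proof.
rewrite sum_ffunE (bigD1 j) //= big1 ?addr0 => [|i ij].
  by rewrite ffunMzE ffunE eqxx intz.
rewrite ffunMzE ffunE /=; case: eqP => [e|]; last by rewrite mul0rz.
(* The entry at position 1, which exists because [l] is positive, identifies the neighbour. *)
have := congr1 (fun t : l.+1.-tuple G => entry t 1) e.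
rewrite !entry_alt //= => /enum_val_inj e1.
by rewrite e1 eqxx in ij.
Qed.

Lemma alt_chain_cycle v : alt_chain v \in @cycles_pred G x l l.
Proof.
apply/andP; split.
  apply/forallP => t; apply/implyP; apply: contraNT => tx.
  rewrite sum_ffunE big1 // => j _; rewrite ffunMzE ffunE.
  case: eqP => [e|]; last by rewrite mul0rz.
  by rewrite e entry_alt ?eqxx in tx.
rewrite /is_cycle /= raddf_sum big1 //= => j _.
by rewrite raddfMz /= boundary_alt ?mul0rz // adj_enum_val.
Qed.

(** By [cycle_support], a nonzero coefficient can only sit on some [alt_gen j], with [j] the rank of
    the second vertex among the neighbours of [x]. *)
Lemma cycle_eq0 (z : cycles x l l) :
  (forall j, chain_of_cycle z (alt_gen j) = 0) -> z = 0.
Proof.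
case: z => c cz; have /andP[/forallP cx /eqP c0] := cz.
move=> cj; apply/val_inj/ffunP => t; rewrite [RHS]ffunE /=.
apply/eqP/contraT => ct; have := cx t; rewrite ct /= => /eqP tx.
have tE := cycle_support hgir c0 tx ct.
have xt : adj x (entry (val t) 1).
  by have /is_gen_walkP/(_ 0%N isT) := valP t; rewrite tx.
have yN : entry (val t) 1 \in [set y | adj x y] by rewrite inE.
have te : t = alt_gen (enum_rank_in yN (entry (val t) 1)).
  by apply: val_inj; rewrite /= enum_rankK_in.
by move: ct; rewrite te cj eqxx.
Qed.

Definition coords (z : MH x l l) : 'rV[int]_(deg x) :=
  \row_j chain_of_cycle (repr z) (alt_gen j).

Lemma coords_pi z : coords (\pi z) = \row_j chain_of_cycle z (alt_gen j).
Proof. by rewrite /coords repr_pi. Qed.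

Lemma coords_zmod_morphism : zmod_morphism coords.
Proof.
move=> p q; rewrite -[p]reprK -[q]reprK -raddfB !coords_pi.
by apply/rowP => j; rewrite !mxE !ffunE.
Qed.

HB.instance Definition _ :=
  GRing.isZmodMorphism.Build (MH x l l) 'rV[int]_(deg x) coords
    coords_zmod_morphism.

Lemma coords_bij : bijective coords.
Proof.
exists (fun v => \pi_(MH x l l) (Cycle (alt_chain_cycle v))) => [z|v]; last first.
  by rewrite coords_pi; apply/rowP => j; rewrite mxE alt_chain_gen.
(* The rebuilt cycle and the representative differ by a cycle whose coordinates all vanish. *)
rewrite -[RHS]reprK; congr (\pi _); apply/eqP; rewrite -subr_eq0; apply/eqP.
by apply: cycle_eq0 => j; rewrite !ffunE /= alt_chain_gen mxE subrr.
Qed.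

End Isomorphism.

Local Close Scope ring_scope.

Theorem theorem1p1 (G : graph) (x : G) (l : nat) (hl : (1 <= l)%N)
    (hgir : leqx (Some 5) (local_girth x)) :
  isomorphic (MH x l l) 'rV[int]_(deg x).
Proof.
case: l hl => // n _.
by exists (@coords G x n); exact: coords_bij.
Qed.
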